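(* Let $q$ be an even prime power and let $L$ be a line of $\mathrm{PG}(5,q)$ in the $K$-orbit $o_{13,3}$. Then the hyperplane-orbit distribution of $L$ is $OD_4(L)=\left[1,\,\frac{q^2+3q}{2},\,\frac{q^2+q}{2},\,q^3-q\right]$.
   Context: A point $(y_0,\dots,y_5)$ of $\mathrm{PG}(5,q)$ is identified with the nonzero symmetric matrix $\begin{bmatrix} y_0&y_1&y_2\\ y_1&y_3&y_4\\ y_2&y_4&y_5\end{bmatrix}$ up to scalar. $K\cong\mathrm{PGL}(3,q)$ acts by $M\mapsto AMA^T$, $A\in\mathrm{GL}(3,q)$. The orbit $o_{13,3}$ (defined only for $q$ even) is the $K$-orbit of the line $\left\{\begin{bmatrix} 0&x&0\\ x&x+y&0\\ 0&0&y\end{bmatrix}:(x,y)\in\mathrm{PG}(1,q)\right\}$. Hyperplanes correspond to conics of $\mathrm{PG}(2,q)$ (nonzero quadratic forms up to scalar): $\sum_{0\le i\le j\le2}a_{ij}X_iX_j$ corresponds to $a_{00}Y_0+a_{01}Y_1+a_{02}Y_2+a_{11}Y_3+a_{12}Y_4+a_{22}Y_5=0$. $\mathcal H_1,\mathcal H_{2,r},\mathcal H_{2,i},\mathcal H_3$ are the sets of hyperplanes corresponding respectively to double lines (scalar multiples of squares of linear forms), pairs of distinct real lines (products of two non-proportional linear forms over $\mathbb F_q$), pairs of conjugate imaginary lines (scalar multiples of products of two non-proportional linear forms conjugate over $\mathbb F_{q^2}$), and non-singular conics (those with $4a_{00}a_{11}a_{22}+a_{01}a_{02}a_{12}-a_{00}a_{12}^2-a_{11}a_{02}^2-a_{22}a_{01}^2\ne0$).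 $OD_4(L)=[h_1,h_{2,r},h_{2,i},h_3]$ lists the numbers of hyperplanes in $\mathcal H_1,\mathcal H_{2,r},\mathcal H_{2,i},\mathcal H_3$ containing $L$. *)

(* Defs.v *)
From HB Require Import structures.
From mathcomp Require Import all_boot all_order all_algebra.
From mathcomp Require Import mpoly.

Set Implicit Arguments.
Unset Strict Implicit.
Unset Printing Implicit Defensive.

Import GRing.Theory.
Local Open Scope ring_scope.

(* The point (y0, ..., y5) of PG(5,q) is the line spanned by the symmetric
   matrix [y0 y1 y2; y1 y3 y4; y2 y4 y5]: points are one-dimensional spaces of
   symmetric matrices, and lines and hyperplanes are sets of points. *)
Definition point (F : finFieldType) (M : 'M[F]_3) : {set 'M[F]_3} :=
  [set c *: M | c : F].

Definition PG5 (F : finFieldType) : {set {set 'M[F]_3}} :=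
  [set point M | M : 'M[F]_3 & (M^T == M) && (M != 0)].

Definition act_point (F : finFieldType) (A : 'M[F]_3) (P : {set 'M[F]_3}) :
    {set 'M[F]_3} :=
  [set A *m M *m A^T | M in P].

Definition act_subspace (F : finFieldType) (A : 'M[F]_3)
    (S : {set {set 'M[F]_3}}) : {set {set 'M[F]_3}} :=
  [set act_point A P | P in S].

Definition K_orbit (F : finFieldType) (S : {set {set 'M[F]_3}}) :
    {set {set {set 'M[F]_3}}} :=
  [set act_subspace A S | A : 'M[F]_3 & A \in unitmx].

Definition mx13_3 (F : finFieldType) (x y : F) : 'M[F]_3 :=
  \matrix_(i < 3, j < 3)
    nth 0 (nth [::] [:: [:: 0; x; 0]; [:: x; x + y; 0]; [:: 0; 0; y]] i) j.

Definition line13_3 (F : finFieldType) : {set {set 'M[F]_3}} :=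
  [set point (mx13_3 xy.1 xy.2) | xy : F * F & xy != (0, 0)].

Definition o13_3 (F : finFieldType) : {set {set {set 'M[F]_3}}} :=
  K_orbit (line13_3 F).

(* Only the entries a i j with i <= j are coefficients of the form; the others
   are ignored here, in [hyperplane] and in [disc]. *)
Definition qform (R : fieldType) (a : 'M[R]_3) : {mpoly R[3]} :=
  \sum_(i < 3) \sum_(j < 3 | (i <= j)%N) a i j *: ('X_i * 'X_j).

Definition lform (R : fieldType) (l : 'rV[R]_3) : {mpoly R[3]} :=
  \sum_(i < 3) l 0 i *: 'X_i.

Definition proportional (R : finFieldType) (l m : 'rV[R]_3) : bool :=
  [exists c : R, (l == c *: m) || (m == c *: l)].

(* For i <= j, the entry M i j of a symmetric matrix runs over y0, ..., y5 in
   the order (0,0), (0,1), (0,2), (1,1), (1,2), (2,2). *)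
Definition hyperplane (F : finFieldType) (a : 'M[F]_3) : {set {set 'M[F]_3}} :=
  [set P in PG5 F | [forall M in P,
     \sum_(i < 3) \sum_(j < 3 | (i <= j)%N) a i j * M i j == 0]].

Definition double_line (F : finFieldType) (a : 'M[F]_3) : bool :=
  [exists c : F, exists l : 'rV[F]_3, qform a == c *: lform l ^+ 2].

Definition real_line_pair (F : finFieldType) (a : 'M[F]_3) : bool :=
  [exists l : 'rV[F]_3, exists m : 'rV[F]_3,
     ~~ proportional l m && (qform a == lform l * lform m)].

(* E plays the role of the quadratic extension of F, with embedding iota; its
   nontrivial automorphism over F is x |-> x ^+ #|F|. *)
Definition conj_form (F E : finFieldType) (l : 'rV[E]_3) : 'rV[E]_3 :=
  map_mx (fun x => x ^+ #|F|) l.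

Definition imaginary_line_pair (F E : finFieldType) (iota : {rmorphism F -> E})
    (a : 'M[F]_3) : bool :=
  [exists c : F, exists l : 'rV[E]_3,
     ~~ proportional l (conj_form F l) &&
     (qform (map_mx iota a) == iota c *: (lform l * lform (conj_form F l)))].

Definition disc (F : finFieldType) (a : 'M[F]_3) : F :=
  let a00 := a (inord 0) (inord 0) in let a01 := a (inord 0) (inord 1) in
  let a02 := a (inord 0) (inord 2) in let a11 := a (inord 1) (inord 1) in
  let a12 := a (inord 1) (inord 2) in let a22 := a (inord 2) (inord 2) in
  4%:R * a00 * a11 * a22 + a01 * a02 * a12
    - a00 * a12 ^+ 2 - a11 * a02 ^+ 2 - a22 * a01 ^+ 2.

Definition nonsingular (F : finFieldType) (a : 'M[F]_3) : bool := disc a != 0.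

Definition hyperplanes_of (F : finFieldType) (C : pred 'M[F]_3) :
    {set {set {set 'M[F]_3}}} :=
  [set hyperplane a | a : 'M[F]_3 & (qform a != 0) && C a].

Definition num_containing (F : finFieldType) (L : {set {set 'M[F]_3}})
    (HH : {set {set {set 'M[F]_3}}}) : nat :=
  #|[set H in HH | L \subset H]|.

Definition OD4 (F E : finFieldType) (iota : {rmorphism F -> E})
    (L : {set {set 'M[F]_3}}) : seq nat :=
  [:: num_containing L (hyperplanes_of (@double_line F));
      num_containing L (hyperplanes_of (@real_line_pair F));
      num_containing L (hyperplanes_of (imaginary_line_pair iota));
      num_containing L (hyperplanes_of (@nonsingular F))].

(* Main.v *)
(* Hyperplanes containing L are counted in the representative line, since the
   group acts on hyperplanes by linear substitution in the quadratic form.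
   There, in characteristic 2, they are the forms with a01 = a11 = a22 = t.

   For t = 0 the classification is immediate.  For t = 1 a product of two
   linear forms can be written (p X0 + X1 + s X2) (p' X0 + X1 + s' X2) with
   p + p' = 1 and s s' = 1, and the form determines (p, s) up to the exchange
   with (p', s') <> (p, s).  Over F this gives q (q - 1) / 2 real pairs.  In an
   imaginary pair p' and s' are the conjugates of p and s in E, so p has
   trace 1 and s has norm 1: there are q (q + 1) / 2 of them.  The q ^ 2 singular
   forms with t = 1 are counted by solving disc = 0 for a00 when a12 <> 0,
   and for a02 when a12 = 0. *)
Require Import Defs.
From HB Require Import structures.
From mathcomp Require Import all_boot all_order all_algebra.
From mathcomp Require Import all_fingroup all_solvable all_field.
From mathcomp Require Import zify ring mpoly.

Import GRing.Theory.
Local Open Scope ring_scope.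

(** * Coordinates of ternary quadratic forms *)

Local Notation i0 := (inord 0 : 'I_3).
Local Notation i1 := (inord 1 : 'I_3).
Local Notation i2 := (inord 2 : 'I_3).

(** A form ignores the entries below the diagonal, so two matrices encode the same form when these
    six entries agree; equality of matrices would be too strong. *)
Definition coefs {R : Type} (a : 'M[R]_3) :=
  (a i0 i0, a i0 i1, a i0 i2, a i1 i1, a i1 i2, a i2 i2).

Definition mat6 {R : nzRingType} (x00 x01 x02 x11 x12 x22 : R) : 'M[R]_3 :=
  \matrix_(i < 3, j < 3)
    nth 0 (nth [::] [:: [:: x00; x01; x02]; [:: 0; x11; x12]; [:: 0; 0; x22]] i) j.

Definition row3 {R : nzRingType} (x y z : R) : 'rV[R]_3 :=
  \row_j nth 0 [:: x; y; z] j.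

Lemma coefs_mat6 (R : nzRingType) (x00 x01 x02 x11 x12 x22 : R) :
  coefs (mat6 x00 x01 x02 x11 x12 x22) = (x00, x01, x02, x11, x12, x22).
Proof. by rewrite /coefs !mxE !inordK. Qed.

Lemma row3E (R : nzRingType) (x y z : R) :
  (row3 x y z 0 i0 = x) * (row3 x y z 0 i1 = y) * (row3 x y z 0 i2 = z).
Proof. by rewrite !mxE !inordK. Qed.

Lemma ord3_ind (P : 'I_3 -> Prop) : P i0 -> P i1 -> P i2 -> forall i, P i.
Proof.
move=> P0 P1 P2 i; rewrite -(inord_val i).
by case: i => [[|[|[|i]]] lti].
Qed.

Lemma sum_ord3 (V : nmodType) (f : 'I_3 -> V) :
  \sum_(i < 3) f i = f i0 + f i1 + f i2.
Proof.
rewrite !big_ord_recl big_ord0 addr0 addrA.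
by congr (f _ + f _ + f _); apply: val_inj; rewrite /= ?inordK.
Qed.

Lemma sum_upper3 (V : nmodType) (f : 'I_3 -> 'I_3 -> V) :
  \sum_(i < 3) \sum_(j < 3 | (i <= j)%N) f i j =
  f i0 i0 + f i0 i1 + f i0 i2 + f i1 i1 + f i1 i2 + f i2 i2.
Proof.
rewrite sum_ord3 !(big_mkcond (fun j : 'I_3 => (_ <= j)%N)) /= !sum_ord3.
by rewrite !inordK //= !add0r !addrA.
Qed.

Lemma meval_qform (R : fieldType) (a : 'M[R]_3) (x y z : R) :
  (qform a).@[row3 x y z 0] =
  a i0 i0 * x ^+ 2 + a i0 i1 * (x * y) + a i0 i2 * (x * z) + a i1 i1 * y ^+ 2
  + a i1 i2 * (y * z) + a i2 i2 * z ^+ 2.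
Proof.
by rewrite /qform sum_upper3 !mevalD !mevalZ !mevalM !mevalXU !row3E !expr2.
Qed.

Lemma qform_eqP (R : fieldType) (a b : 'M[R]_3) :
  reflect (coefs a = coefs b) (qform a == qform b).
Proof.
apply: (iffP eqP) => [ab | [h00 h01 h02 h11 h12 h22]]; last first.
  by rewrite /qform !sum_upper3 h00 h01 h02 h11 h12 h22.
have ev x y z := congr1 (meval (row3 x y z 0)) ab.
(* Unit vectors isolate the diagonal coefficients; each sum of two of them then isolates a mixed
   one. *)
move: (ev 1 0 0) (ev 0 1 0) (ev 0 0 1) (ev 1 1 0) (ev 1 0 1) (ev 0 1 1).
rewrite !meval_qform !(expr0n, expr1n, mulr0, mul0r, mulr1, addr0, add0r).
by rewrite /coefs => -> -> -> /addIr/addrI-> /addIr/addrI-> /addIr/addrI->.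
Qed.

Lemma lform_mul (R : fieldType) (l m : 'rV[R]_3) :
  lform l * lform m = qform (mat6
    (l 0 i0 * m 0 i0) (l 0 i0 * m 0 i1 + l 0 i1 * m 0 i0)
    (l 0 i0 * m 0 i2 + l 0 i2 * m 0 i0) (l 0 i1 * m 0 i1)
    (l 0 i1 * m 0 i2 + l 0 i2 * m 0 i1) (l 0 i2 * m 0 i2)).
Proof.
rewrite /qform sum_upper3; have [-> -> -> -> -> ->] := coefs_mat6 R
  (l 0 i0 * m 0 i0) (l 0 i0 * m 0 i1 + l 0 i1 * m 0 i0)
  (l 0 i0 * m 0 i2 + l 0 i2 * m 0 i0) (l 0 i1 * m 0 i1)
  (l 0 i1 * m 0 i2 + l 0 i2 * m 0 i1) (l 0 i2 * m 0 i2).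
rewrite /lform !sum_ord3 -!mul_mpolyC !rmorphD !rmorphM; ring.
Qed.

Lemma lformZ (R : fieldType) (c : R) (l : 'rV[R]_3) :
  lform (c *: l) = c *: lform l.
Proof. by rewrite /lform scaler_sumr; apply: eq_bigr => i _; rewrite mxE scalerA. Qed.

Definition lform2_coefs {R : nzRingType} (c : R) (l m : 'rV[R]_3) :=
  (c * (l 0 i0 * m 0 i0), c * (l 0 i0 * m 0 i1 + l 0 i1 * m 0 i0),
   c * (l 0 i0 * m 0 i2 + l 0 i2 * m 0 i0), c * (l 0 i1 * m 0 i1),
   c * (l 0 i1 * m 0 i2 + l 0 i2 * m 0 i1), c * (l 0 i2 * m 0 i2)).

Lemma qform_lform2P (R : fieldType) (a : 'M[R]_3) (c : R) (l m : 'rV[R]_3) :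
  reflect (coefs a = lform2_coefs c l m) (qform a == c *: (lform l * lform m)).
Proof.
rewrite scalerAl -lformZ lform_mul.
rewrite /lform2_coefs; apply: (iffP (qform_eqP _ _ _)) => ->;
  rewrite coefs_mat6 !mxE;
  by congr (_, _, _, _, _, _); ring.
Qed.

(** The left side of the equation of [hyperplane a]. Each mixed entry counts once, so no form is
    lost in characteristic 2 (see [bform_inj]). *)
Definition bform {R : nzRingType} (a M : 'M[R]_3) : R :=
  \sum_(i < 3) \sum_(j < 3 | (i <= j)%N) a i j * M i j.

(* The form x |-> Q_a(x A^T), where Q_a is the form with coefficients a. *)
Definition cong {R : comNzRingType} (A a : 'M[R]_3) : 'M[R]_3 :=
  let d i := \sum_(k < 3) \sum_(l < 3 | (k <= l)%N) a k l * (A k i * A l i) in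
  let p i j := \sum_(k < 3) \sum_(l < 3 | (k <= l)%N)
                 a k l * (A k i * A l j + A k j * A l i) in
  mat6 (d i0) (p i0 i1) (p i0 i2) (d i1) (p i1 i2) (d i2).

Lemma mulmxE3 (R : nzRingType) m n (A : 'M[R]_(m, 3)) (B : 'M[R]_(3, n)) i j :
  (A *m B) i j = A i i0 * B i0 j + A i i1 * B i1 j + A i i2 * B i2 j.
Proof. by rewrite mxE sum_ord3. Qed.

Lemma det3 (R : comNzRingType) (A : 'M[R]_3) :
  \det A = A i0 i0 * (A i1 i1 * A i2 i2 - A i1 i2 * A i2 i1)
         - A i0 i1 * (A i1 i0 * A i2 i2 - A i1 i2 * A i2 i0)
         + A i0 i2 * (A i1 i0 * A i2 i1 - A i1 i1 * A i2 i0).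
Proof.
have liftE (h : 'I_3) (k : 'I_2) : lift h k = inord (bump h k).
  by apply: val_inj; rewrite [RHS]inordK //; apply: (ltn_ord (lift h k)).
rewrite (expand_det_row _ i0) sum_ord3 /cofactor.
rewrite !(expand_det_row _ (0 : 'I_2)) !big_ord_recl !big_ord0 /cofactor !det_mx11 !mxE.
rewrite !liftE /bump /= !inordK //= /bump /= !(addn0, add0n, addn1); ring.
Qed.

(** Substitution is adjoint to congruence: on a rank-one matrix x^T x the pairing is Q_a(x), and
    congruence by [A] replaces x by x A^T. This carries the action from points to hyperplanes. *)
Lemma bform_cong (R : comNzRingType) (A a M : 'M[R]_3) :
  M^T = M -> bform (cong A a) M = bform a (A *m M *m A^T).
Proof.
move=> symM; have symE i j : M i j = M j i by rewrite -[in LHS]symM mxE.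
rewrite /bform !sum_upper3; have [-> -> -> -> -> ->] := coefs_mat6 R
  _ _ _ _ _ _ : coefs (cong A a) = _.
rewrite !sum_upper3 !mulmxE3 !(mxE trmx_key).
rewrite (symE i1 i0) (symE i2 i0) (symE i2 i1); ring.
Qed.

(** Over the integers, 2 [disc] is the determinant of the symmetric matrix with 2 a_ii on the
    diagonal and a_ij off it. The resulting polynomial identity survives in characteristic 2. *)
Lemma disc_cong (F : finFieldType) (k : F) (A a b : 'M[F]_3) :
  coefs b = coefs (k *: cong A a) -> disc b = k ^+ 3 * \det A ^+ 2 * disc a.
Proof.
rewrite /coefs !(mxE scalemx_key) => -[]; have [-> -> -> -> -> ->] := coefs_mat6 F
  _ _ _ _ _ _ : coefs (cong A a) = _.
rewrite /disc det3 !sum_upper3 => -> -> -> -> -> ->; ring.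
Qed.

(** * The action on hyperplanes *)

Lemma bformBZ (R : comNzRingType) (a M N : 'M[R]_3) (k : R) :
  bform a (M - k *: N) = bform a M - k * bform a N.
Proof. rewrite /bform !sum_upper3 !mxE; ring. Qed.

Lemma bformZ (R : comNzRingType) (a M : 'M[R]_3) (k : R) :
  bform a (k *: M) = k * bform a M.
Proof. rewrite /bform !sum_upper3 !mxE; ring. Qed.

Lemma bformZl (R : comNzRingType) (a M : 'M[R]_3) (k : R) :
  bform (k *: a) M = k * bform a M.
Proof. rewrite /bform !sum_upper3 !mxE; ring. Qed.

Lemma eq_bform (R : nzRingType) (a b M : 'M[R]_3) :
  coefs a = coefs b -> bform a M = bform b M.
Proof. by case=> h00 h01 h02 h11 h12 h22; rewrite /bform !sum_upper3 h00 h01 h02 h11 h12 h22. Qed.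

Lemma bform_inj (R : comNzRingType) (a b : 'M[R]_3) :
  (forall M : 'M[R]_3, M^T = M -> bform a M = bform b M) -> coefs a = coefs b.
Proof.
move=> ab.
pose S (x00 x01 x02 x11 x12 x22 : R) : 'M[R]_3 := \matrix_(i < 3, j < 3)
  nth 0 (nth [::] [:: [:: x00; x01; x02]; [:: x01; x11; x12]; [:: x02; x12; x22]] i) j.
have bS c x00 x01 x02 x11 x12 x22 : bform c (S x00 x01 x02 x11 x12 x22) =
    c i0 i0 * x00 + c i0 i1 * x01 + c i0 i2 * x02 + c i1 i1 * x11
    + c i1 i2 * x12 + c i2 i2 * x22.
  by rewrite /bform sum_upper3 !mxE !inordK.
have Ssym x00 x01 x02 x11 x12 x22 :
    (S x00 x01 x02 x11 x12 x22)^T = S x00 x01 x02 x11 x12 x22.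
  by apply/matrixP; elim/ord3_ind; elim/ord3_ind; rewrite !mxE !inordK.
have e x00 x01 x02 x11 x12 x22 := ab _ (Ssym x00 x01 x02 x11 x12 x22).
move: (e 1 0 0 0 0 0) (e 0 1 0 0 0 0) (e 0 0 1 0 0 0) (e 0 0 0 1 0 0)
  (e 0 0 0 0 1 0) (e 0 0 0 0 0 1).
by rewrite !bS !(mulr0, mulr1, addr0, add0r) /coefs => -> -> -> -> -> ->.
Qed.

(** Provides a symmetric matrix off the hyperplane, which can be moved by congruence and used to
    normalise an equation. *)
Lemma qform_neq0P (R : finFieldType) (a : 'M[R]_3) :
  reflect (exists2 M : 'M[R]_3, M^T = M & bform a M != 0) (qform a != 0).
Proof.
have q0 : qform (0 : 'M[R]_3) = 0 by rewrite /qform sum_upper3 !mxE !scale0r !addr0.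
have b0 (M : 'M[R]_3) : bform 0 M = 0 by rewrite /bform sum_upper3 !mxE !mul0r !addr0.
rewrite -q0; apply: (iffP idP) => [|[M _ aM0]]; last first.
  by apply: contraNN aM0 => /qform_eqP/(eq_bform R _ _ M)->; rewrite b0.
case: (boolP [exists M : 'M[R]_3, (M^T == M) && (bform a M != 0)]).
  by case/existsP=> M /andP[/eqP symM aM] _; exists M.
rewrite negb_exists => /forallP aM /negP[]; apply/qform_eqP.
apply: bform_inj => M symM; rewrite b0; apply/eqP.
by have := aM M; rewrite symM eqxx negbK.
Qed.

Lemma mem_point (F : finFieldType) (M : 'M[F]_3) : M \in point M.
Proof. by apply/imsetP; exists 1; rewrite ?scale1r. Qed.

Lemma point_in_PG5 (F : finFieldType) (M : 'M[F]_3) :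
  M^T = M -> M != 0 -> point M \in PG5 F.
Proof. by move=> symM M0; apply/imsetP; exists M; rewrite ?inE ?symM ?eqxx. Qed.

Lemma PG5P (F : finFieldType) (P : {set 'M[F]_3}) :
  reflect (exists M : 'M[F]_3, [/\ M^T = M, M != 0 & P = point M]) (P \in PG5 F).
Proof.
apply: (iffP imsetP) => [[M]|[M [symM M0 ->]]].
  by rewrite inE => /andP[/eqP symM M0] ->; exists M.
by exists M; rewrite // inE symM eqxx.
Qed.

Lemma point_in_hyperplane (F : finFieldType) (a M : 'M[F]_3) :
  M^T = M -> M != 0 -> (point M \in hyperplane a) = (bform a M == 0).
Proof.
move=> symM M0; rewrite inE point_in_PG5 //=.
apply/forallP/eqP => [/(_ M)|aM N].
  by rewrite mem_point /= => /eqP.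
by apply/implyP => /imsetP[c _ ->]; apply/eqP; rewrite -[LHS]/(bform _ _) bformZ aM mulr0.
Qed.

Lemma hyperplaneP (F : finFieldType) (a : 'M[F]_3) (P : {set 'M[F]_3}) :
  reflect (exists M : 'M[F]_3, [/\ M^T = M, M != 0, P = point M & bform a M = 0])
          (P \in hyperplane a).
Proof.
apply: (iffP idP) => [aP|[M [symM M0 -> aM]]]; last first.
  by rewrite point_in_hyperplane // aM.
have /PG5P[M [symM M0 defP]] : P \in PG5 F by move: aP; rewrite inE => /andP[].
by exists M; split=> //; apply/eqP; rewrite -point_in_hyperplane // -defP.
Qed.

Lemma act_point_point (F : finFieldType) (A M : 'M[F]_3) :
  act_point A (point M) = point (A *m M *m A^T).
Proof.
apply/setP=> N; apply/imsetP/imsetP => [[_ /imsetP[c _ ->] ->]|[c _ ->]].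
  by exists c; rewrite // -scalemxAr -scalemxAl.
exists (c *: M); first by apply/imsetP; exists c.
by rewrite -scalemxAr -scalemxAl.
Qed.

Lemma congruenceK (F : finFieldType) (A M : 'M[F]_3) :
  A \in unitmx -> invmx A *m (A *m M *m A^T) *m (invmx A)^T = M.
Proof.
by move=> uA; rewrite trmx_inv !mulmxA mulVmx // mul1mx mulmxK // unitmx_tr.
Qed.

Lemma congruence_neq0 (F : finFieldType) (A M : 'M[F]_3) :
  A \in unitmx -> M != 0 -> A *m M *m A^T != 0.
Proof.
move=> uA; apply: contraNneq => AM0.
by rewrite -(congruenceK F A M uA) AM0 mulmx0 mul0mx.
Qed.

Lemma congruence_sym (R : comNzRingType) (A M : 'M[R]_3) :
  M^T = M -> (A *m M *m A^T)^T = A *m M *m A^T.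
Proof. by move=> symM; rewrite !trmx_mul trmxK symM mulmxA. Qed.

Lemma act_subspaceK (F : finFieldType) (A : 'M[F]_3) (S : {set {set 'M[F]_3}}) :
  A \in unitmx -> act_subspace (invmx A) (act_subspace A S) = S.
Proof.
move=> uA; have actK P : act_point (invmx A) (act_point A P) = P.
  rewrite /act_point -imset_comp -[RHS]imset_id.
  by apply: eq_imset => M; rewrite /= congruenceK.
by rewrite /act_subspace -imset_comp -[RHS]imset_id; apply: eq_imset => P; rewrite /= actK.
Qed.

(** A matrix N lies in the image when A^-1 N A^-T satisfies the old equation; by [bform_cong] this
    substitutes the inverse of [A] in the form. *)
Lemma act_hyperplane (F : finFieldType) (A a : 'M[F]_3) :
  A \in unitmx -> act_subspace A (hyperplane a) = hyperplane (cong (invmx A) a).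
Proof.
move=> uA; apply/setP=> P; apply/imsetP/hyperplaneP.
  move=> [_ /hyperplaneP[M [symM M0 -> aM]] ->]; exists (A *m M *m A^T).
  rewrite act_point_point congruence_sym ?congruence_neq0 //; split=> //.
  by rewrite bform_cong ?congruence_sym // congruenceK.
move=> [M [symM M0 -> aM]]; have uA' : invmx A \in unitmx by rewrite unitmx_inv.
exists (point (invmx A *m M *m (invmx A)^T)).
  apply/hyperplaneP; exists (invmx A *m M *m (invmx A)^T).
  by rewrite congruence_sym ?congruence_neq0 // -bform_cong.
by rewrite act_point_point -[in LHS](congruenceK F _ M uA') invmxK.
Qed.

(** Invariance under scalars and invertible substitutions. One implication is enough, since the
    converse comes from the inverse scalar and substitution. *)
Definition conic_class (F : finFieldType) (C : pred 'M[F]_3) : Prop :=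
  forall (k : F) (A a b : 'M[F]_3), k != 0 -> A \in unitmx ->
    coefs b = coefs (k *: cong A a) -> C a -> C b.

Lemma qform_cong_neq0 (F : finFieldType) (A a : 'M[F]_3) :
  A \in unitmx -> qform a != 0 -> qform (cong A a) != 0.
Proof.
move=> uA /qform_neq0P[M symM aM].
have uA' : invmx A \in unitmx by rewrite unitmx_inv.
apply/qform_neq0P; exists (invmx A *m M *m (invmx A)^T); first exact: congruence_sym.
rewrite bform_cong ?congruence_sym //.
by have := congruenceK F _ M uA'; rewrite invmxK => ->.
Qed.

(** The action of [A] is injective on sets of points, preserves the class and sends hyperplanes
    through [L] to hyperplanes through its image. *)
Lemma leq_num_containing_act (F : finFieldType) (C : pred 'M[F]_3)
    (A : 'M[F]_3) (L : {set {set 'M[F]_3}}) :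
  conic_class F C -> A \in unitmx ->
  (num_containing L (hyperplanes_of C) <=
   num_containing (act_subspace A L) (hyperplanes_of C))%N.
Proof.
move=> clC uA; rewrite /num_containing.
rewrite -(card_imset _ (can_inj (fun S => act_subspaceK F A S uA))).
apply/subset_leq_card/subsetP => _ /imsetP[_ /setIdP[/imsetP[a] + ->] La ->].
rewrite !inE => /andP[a0 Ca]; rewrite imsetS // andbT act_hyperplane //.
have uA' : invmx A \in unitmx by rewrite unitmx_inv.
apply/imsetP; exists (cong (invmx A) a) => //; rewrite !inE qform_cong_neq0 //=.
by apply: clC (oner_neq0 F) uA' _ Ca; rewrite scale1r.
Qed.

(** The preceding inequality, used for [A] and for its inverse. *)
Lemma num_containing_orbit (F : finFieldType) (C : pred 'M[F]_3)
    (L0 L : {set {set 'M[F]_3}}) :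
  conic_class F C -> L \in K_orbit L0 ->
  num_containing L (hyperplanes_of C) = num_containing L0 (hyperplanes_of C).
Proof.
move=> clC /imsetP[A]; rewrite inE => uA ->; apply/eqP; rewrite eqn_leq.
rewrite leq_num_containing_act // andbT.
rewrite -{2}(act_subspaceK F A L0 uA) leq_num_containing_act //.
by rewrite unitmx_inv.
Qed.

Lemma eq_hyperplane (F : finFieldType) (a b : 'M[F]_3) (k : F) :
  k != 0 -> coefs b = coefs (k *: a) -> hyperplane b = hyperplane a.
Proof.
move=> k0 eb; have eM M : (bform b M == 0) = (bform a M == 0).
  by rewrite (eq_bform _ _ _ M eb) bformZl mulf_eq0 (negPf k0).
apply/setP=> P; apply/hyperplaneP/hyperplaneP => -[M [symM M0 -> /eqP aM]];
  by exists M; split=> //; apply/eqP; rewrite ?eM // -eM.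
Qed.

(** Functionals with the same kernel are proportional: for N off the kernel of [a], subtracting
    (a(M) / a(N)) N from M gives an element of the kernel of [a], hence of [b]. *)
Lemma hyperplane_inj (F : finFieldType) (a b : 'M[F]_3) :
  qform a != 0 -> qform b != 0 -> hyperplane a = hyperplane b ->
  exists2 k : F, k != 0 & coefs b = coefs (k *: a).
Proof.
move=> /qform_neq0P[N symN aN] /qform_neq0P[N' symN' bN'] ab.
have eM (M : 'M[F]_3) : M^T = M -> (bform a M == 0) = (bform b M == 0).
  move=> symM; have [->|M0] := eqVneq M 0.
    by rewrite -(scale0r 0) !bformZ !mul0r.
  by rewrite -!point_in_hyperplane // ab.
exists (bform b N / bform a N).
  by rewrite mulf_neq0 ?invr_eq0 // -eM.
apply: bform_inj => M symM; rewrite bformZl.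
have /eqP : bform b (M - (bform a M / bform a N) *: N) = 0.
  apply/eqP; rewrite -eM; last by rewrite linearB linearZ /= symM symN.
  by rewrite bformBZ divfK ?subrr.
rewrite bformBZ subr_eq0 => /eqP->; ring.
Qed.

(** * Characteristic 2, conjugation, and substitution in linear factors *)

Lemma pnat2_even_card (F : finFieldType) : ~~ odd #|F| -> 2%N.-nat #|F|.
Proof.
move=> evF; have [p p_pr charFp] := finPcharP F.
(* The additive group is an elementary abelian p-group, so the order of [F] is a power of its
   characteristic. *)
have pF : p.-nat #|F|.
  by rewrite -cardsT; apply: abelem_pgroup; apply: fin_ring_pchar_abelem.
suff <- : p = 2%N by [].
have : 2%N \in \pi(#|F|).
  by rewrite mem_primes /= dvdn2 evF andbT; apply/card_gt0P; exists 0.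
by move/(pnatPpi pF); rewrite inE => /eqP.
Qed.

Lemma pchar2_even_card (F : finFieldType) : ~~ odd #|F| -> 2 \in [pchar F].
Proof.
by move=> evF; have /p_natP[n cardF] := pnat2_even_card F evF; apply: card_finPcharP cardF _.
Qed.

Lemma frobenius_additive (F E : finFieldType) (iota : {rmorphism F -> E}) (x y : E) :
  ~~ odd #|F| -> (x + y) ^+ #|F| = x ^+ #|F| + y ^+ #|F|.
Proof.
move=> evF; apply: exprDn_pchar.
apply: sub_in_pnat (pnat2_even_card F evF) => p _; rewrite inE => /eqP->.
by rewrite (fmorph_pchar iota) pchar2_even_card.
Qed.

(** Conjugation is additive and multiplicative and fixes the entries coming from [F], so
    substitutions over [F] preserve conjugate pairs. *)
Lemma conj_form_mulmx (F E : finFieldType) (iota : {rmorphism F -> E})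
    (l : 'rV[E]_3) (A : 'M[F]_3) :
  ~~ odd #|F| ->
  conj_form F (l *m map_mx iota A) = conj_form F l *m map_mx iota A.
Proof.
move=> evF; apply/matrixP=> i j; rewrite [LHS]mxE !mulmxE3 !(mxE map_mx_key).
by rewrite !(frobenius_additive F E iota) // !exprMn -!rmorphXn !expf_card.
Qed.

Lemma map_cong (R S : comNzRingType) (f : {rmorphism R -> S}) (A a : 'M[R]_3) :
  coefs (map_mx f (cong A a)) = coefs (cong (map_mx f A) (map_mx f a)).
Proof.
rewrite coefs_mat6 !sum_upper3 /coefs !(mxE map_mx_key) !mxE !inordK //=.
by rewrite !sum_upper3 !(rmorphD, rmorphM).
Qed.

Lemma cong_lform2 (R : comNzRingType) (k c : R) (l m : 'rV[R]_3) (A a b : 'M[R]_3) :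
  coefs b = coefs (k *: cong A a) -> coefs a = lform2_coefs c l m ->
  coefs b = lform2_coefs (k * c) (l *m A) (m *m A).
Proof.
rewrite [coefs b]/coefs /(coefs (k *: _)) !(mxE scalemx_key).
have [-> -> -> -> -> ->] := coefs_mat6 R _ _ _ _ _ _ : coefs (cong A a) = _.
rewrite !sum_upper3 /lform2_coefs !mulmxE3.
move=> [-> -> -> -> -> ->] [-> -> -> -> -> ->].
by congr (_, _, _, _, _, _); ring.
Qed.

Lemma proportional_mulmx (F : finFieldType) (A : 'M[F]_3) (l m : 'rV[F]_3) :
  A \in unitmx -> proportional (l *m A) (m *m A) = proportional l m.
Proof.
move=> uA; apply: eq_existsb => c.
by rewrite !scalemxAl !(can_eq (mulmxK uA)).
Qed.

(** * Invariance of the four classes of conics *)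

Lemma double_line_class (F : finFieldType) : conic_class F (@double_line F).
Proof.
move=> k A a b _ _ eb /existsP[c /existsP[l /qform_lform2P ea]].
apply/existsP; exists (k * c); apply/existsP; exists (l *m A).
by apply/qform_lform2P; apply: cong_lform2 eb ea.
Qed.

Lemma real_line_pair_class (F : finFieldType) : conic_class F (@real_line_pair F).
Proof.
move=> k A a b k0 uA eb /existsP[l /existsP[m /andP[lm]]].
rewrite -[_ * _]scale1r => /qform_lform2P ea.
(* A real line pair carries no separate scalar, so [k] is absorbed into the first factor; the ratio
   in a proportionality then changes by [k]. *)
apply/existsP; exists (k *: (l *m A)); apply/existsP; exists (m *m A).
apply/andP; split.
  apply: contra lm => /existsP[c].
  rewrite -(proportional_mulmx _ A) // => /orP[] /eqP e; apply/existsP.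
    by exists (k^-1 * c); rewrite -scalerA -e scalerK ?eqxx.
  by exists (c * k); rewrite -(scalerA c k (l *m A)) -e eqxx orbT.
rewrite lformZ -scalerAl; apply/qform_lform2P.
have := cong_lform2 F _ _ _ _ _ _ _ eb ea.
by rewrite mulr1.
Qed.

Lemma imaginary_line_pair_class (F E : finFieldType) (iota : {rmorphism F -> E}) :
  ~~ odd #|F| -> conic_class F (imaginary_line_pair iota).
Proof.
move=> evF k A a b k0 uA eb /existsP[c /existsP[l /andP[ll /qform_lform2P ea]]].
apply/existsP; exists (k * c); apply/existsP; exists (l *m map_mx iota A).
rewrite conj_form_mulmx // proportional_mulmx ?map_unitmx // ll /=.
apply/qform_lform2P; rewrite rmorphM; apply: cong_lform2 ea.
have -> : coefs (iota k *: cong (map_mx iota A) (map_mx iota a)) =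
          coefs (map_mx iota (k *: cong A a)).
  by have := map_cong _ _ iota A a; rewrite map_mxZ /coefs !(mxE scalemx_key) => -[-> -> -> -> -> ->].
by move: eb; rewrite /coefs !(mxE map_mx_key) => -[-> -> -> -> -> ->].
Qed.

Lemma nonsingular_class (F : finFieldType) : conic_class F (@nonsingular F).
Proof.
move=> k A a b k0 uA /disc_cong; rewrite /nonsingular => ->.
by move: uA; rewrite unitmxE unitfE => dA a0; rewrite !mulf_neq0 // expf_neq0.
Qed.

(** * Normalised forms vanishing on the representative line *)

(* The points (a00 : a02 : a12 : t) of PG(3,q), each normalised by its last
   nonzero coordinate in the order a00, a02, a12, t. *)
Definition conic_rep (F : finFieldType) : finType :=
  (F * F * F + F * F + F + unit)%type.

Definition pencil {R : nzRingType} (a b c t : R) : 'M[R]_3 := mat6 a t b t c t.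

Lemma pencilE (R : nzRingType) (a b c t : R) :
  ((pencil a b c t i0 i0 = a) * (pencil a b c t i0 i1 = t) *
   (pencil a b c t i0 i2 = b) * (pencil a b c t i1 i1 = t) *
   (pencil a b c t i1 i2 = c) * (pencil a b c t i2 i2 = t))%type.
Proof. by have [-> -> -> -> -> ->] := coefs_mat6 R a t b t c t. Qed.

Definition conic_of_rep {F : finFieldType} (r : conic_rep F) : 'M[F]_3 :=
  match r with
  | inl (inl (inl (a, b, c))) => pencil a b c 1
  | inl (inl (inr (a, b))) => pencil a b 1 0
  | inl (inr a) => pencil a 1 0 0
  | inr _ => pencil 1 0 0 0
  end.

(** The last nonzero coordinate of a representative is 1: proportional representatives lie in the
    same summand, and there [k] is 1. *)
Lemma conic_of_rep_inj (F : finFieldType) (r s : conic_rep F) (k : F) :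
  coefs (conic_of_rep s) = coefs (k *: conic_of_rep r) -> k != 0 -> r = s.
Proof.
rewrite /coefs !(mxE scalemx_key).
case: r => [[[[[a b] c]|[a b]]|a]|[]]; case: s => [[[[[a' b'] c']|[a' b']]|a']|[]];
  rewrite /= !pencilE.
(* Of the 16 cases, 12 compare different summands and contradict [k != 0] or [1 != 0]. *)
all: rewrite ?mulr0 ?mulr1 => e /eqP k0; have /eqP n := oner_neq0 F; case: e => *; subst;
  first [by exfalso; congruence | by rewrite ?mul1r].
Qed.

Lemma coefs_neq0 (R : fieldType) (a : 'M[R]_3) :
  (qform a != 0) = (coefs a != (0, 0, 0, 0, 0, 0)).
Proof.
have <- : qform (mat6 0 0 0 0 0 0 : 'M[R]_3) = 0.
  rewrite /qform sum_upper3; have [-> -> -> -> -> ->] := coefs_mat6 R 0 0 0 0 0 0.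
  by rewrite !scale0r !addr0.
by rewrite -(coefs_mat6 R 0 0 0 0 0 0) (sameP (qform_eqP _ _ _) eqP).
Qed.

Lemma conic_of_rep_neq0 (F : finFieldType) (r : conic_rep F) :
  qform (conic_of_rep r) != 0.
Proof.
rewrite coefs_neq0 /coefs.
by case: r => [[[[[a b] c]|[a b]]|a]|[]]; rewrite /= !pencilE !xpair_eqE oner_eq0 ?andbF.
Qed.

Lemma conic_of_repP (F : finFieldType) (a : 'M[F]_3) :
  qform a != 0 -> a i0 i1 = a i1 i1 -> a i1 i1 = a i2 i2 ->
  exists r : conic_rep F, exists2 k : F,
    k != 0 & coefs a = coefs (k *: conic_of_rep r).
Proof.
rewrite coefs_neq0 /coefs => a0 e1 e2; move: a0; rewrite e1 e2.
have [z22|n22] := eqVneq (a i2 i2) 0; last first.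
  move=> _; exists (inl (inl (inl (a i0 i0 / a i2 i2, a i0 i2 / a i2 i2,
    a i1 i2 / a i2 i2)))); exists (a i2 i2) => //.
  by rewrite /= !(mxE scalemx_key) !pencilE !mulr1 !(mulrC (a i2 i2)) !divfK.
rewrite z22; have [z12|n12] := eqVneq (a i1 i2) 0; last first.
  move=> _; exists (inl (inl (inr (a i0 i0 / a i1 i2, a i0 i2 / a i1 i2)))).
  exists (a i1 i2) => //.
  by rewrite /= !(mxE scalemx_key) !pencilE !mulr1 !mulr0 !(mulrC (a i1 i2)) !divfK.
rewrite z12; have [z02|n02] := eqVneq (a i0 i2) 0; last first.
  move=> _; exists (inl (inr (a i0 i0 / a i0 i2))); exists (a i0 i2) => //.
  by rewrite /= !(mxE scalemx_key) !pencilE !mulr1 !mulr0 !(mulrC (a i0 i2)) !divfK.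
rewrite z02; have [->|n00] := eqVneq (a i0 i0) 0; first by rewrite eqxx.
move=> _; exists (inr tt); exists (a i0 i0) => //.
by rewrite /= !(mxE scalemx_key) !pencilE !mulr1 !mulr0.
Qed.

(** On the line the equation reads (a01 + a11) x + (a11 + a22) y = 0, and in characteristic 2 a
    vanishing sum is an equality. *)
Lemma line13_3_subset_hyperplane (F : finFieldType) (a : 'M[F]_3) :
  2%N \in [pchar F] ->
  reflect (a i0 i1 = a i1 i1 /\ a i1 i1 = a i2 i2) (line13_3 F \subset hyperplane a).
Proof.
move=> char2; have sym x y : (mx13_3 x y : 'M[F]_3)^T = mx13_3 x y.
  by apply/matrixP; elim/ord3_ind; elim/ord3_ind; rewrite !mxE !inordK.
have neq0 x y : (x, y) != (0, 0) -> (mx13_3 x y : 'M[F]_3) != 0.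
  rewrite xpair_eqE; apply: contraNneq => /matrixP M0.
  move: (M0 i0 i1) (M0 i2 i2); rewrite !mxE !inordK //= => -> ->.
  by rewrite eqxx.
have bE x y : bform a (mx13_3 x y) = (a i0 i1 + a i1 i1) * x + (a i1 i1 + a i2 i2) * y.
  rewrite /bform sum_upper3 !mxE !inordK //=; ring.
have eq_add (x y : F) : (x + y == 0) = (x == y) by rewrite addr_eq0 oppr_pchar2.
apply: (iffP subsetP) => [La|[e1 e2] P /imsetP[[x y]]]; last first.
  rewrite inE => xy0 ->; rewrite point_in_hyperplane ?sym ?neq0 //.
  by rewrite bE e1 e2 !addrr_pchar2 // !mul0r addr0.
have La0 x y : (x, y) != (0, 0) -> bform a (mx13_3 x y) = 0.
  move=> xy0; apply/eqP; rewrite -point_in_hyperplane ?sym ?neq0 //.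
  by apply: La; apply/imsetP; exists (x, y); rewrite ?inE.
move: (La0 1 0) (La0 0 1); rewrite !xpair_eqE oner_eq0 !andbF /= => /(_ isT) h /(_ isT).
move: h; rewrite !bE !mulr0 !mulr1 addr0 add0r => /eqP + /eqP.
by rewrite !eq_add => /eqP-> /eqP->.
Qed.

(** Each hyperplane through the line has exactly one normalised equation, and rescaling does not
    leave the class. *)
Lemma num_containing_line13_3 (F : finFieldType) (C : pred 'M[F]_3) :
  2%N \in [pchar F] -> conic_class F C ->
  num_containing (line13_3 F) (hyperplanes_of C) =
  #|[set r : conic_rep F | C (conic_of_rep r)]|.
Proof.
move=> char2 clC; pose h (r : conic_rep F) := hyperplane (conic_of_rep r).
rewrite -(card_in_imset (f := h)); last first.
  move=> r s _ _ /hyperplane_inj[||k k0 e]; rewrite ?conic_of_rep_neq0 //.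
  exact: conic_of_rep_inj e k0.
(* Rescaling is the instance of [conic_class] with the identity substitution. *)
have cong1 (k : F) a : coefs (k *: cong 1%:M a) = coefs (k *: a).
  rewrite /coefs !(mxE scalemx_key).
  have [-> -> -> -> -> ->] := coefs_mat6 F _ _ _ _ _ _ : coefs (cong 1%:M a) = _.
  rewrite !sum_upper3 !mxE -!val_eqE /= !inordK //=.
  by congr (_, _, _, _, _, _); ring.
congr #|pred_of_set _|; apply/setP=> H; apply/setIdP/imsetP.
  move=> [/imsetP[a]]; rewrite inE => /andP[a0 Ca] -> /line13_3_subset_hyperplane.
  case/(_ char2) => e1 e2; have [r [k k0 e]] := conic_of_repP F a a0 e1 e2.
  exists r; last exact: eq_hyperplane k0 e.
  rewrite inE; apply: (clC k^-1 1%:M a _ _ (unitmx1 F 3) _ Ca); rewrite ?invr_eq0 //.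
  move: e; rewrite cong1 /coefs !(mxE scalemx_key) => -[-> -> -> -> -> ->].
  by rewrite !mulKf.
move=> [r]; rewrite inE => Cr ->; split.
  by apply/imsetP; exists (conic_of_rep r); rewrite // inE conic_of_rep_neq0.
apply/line13_3_subset_hyperplane => //.
by case: r {Cr} => [[[[[a b] c]|[a b]]|a]|[]]; rewrite /= !pencilE.
Qed.

Lemma card_conic_rep (F : finFieldType) (C : pred 'M[F]_3) :
  #|[set r : conic_rep F | C (conic_of_rep r)]| =
  (#|[set v : F * F * F | C (pencil v.1.1 v.1.2 v.2 1)]|
   + #|[set v : F * F | C (pencil v.1 v.2 1 0)]|
   + #|[set a : F | C (pencil a 1 0 0)]| + C (pencil 1 0 0 0))%N.
Proof.
rewrite -!sum1dep_card !big_sumType /=.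
congr (_ + _ + _ + _)%N; try by apply: eq_bigl => -[[]].
  by apply: eq_bigl => -[].
by rewrite big_mkcond (big_pred1 tt) => [|[] //]; case: (C _).
Qed.

(** * Pairs of lines in the pencil *)

(** Each fibre of [f] on [D] is a pair {x, s x}. Below, [s] exchanges the two linear factors of a
    form. *)
Lemma card_two_to_one (T U : finType) (D : {set T}) (f : T -> U) (s : T -> T) :
  {in D, forall x, [/\ s x \in D, s x != x & f (s x) = f x]} ->
  {in D &, forall x y, f x = f y -> y = x \/ y = s x} ->
  #|D| = (#|f @: D| * 2)%N.
Proof.
move=> sD fD; rewrite -sum1_card (partition_big_imset f) -sum_nat_const /=.
apply: eq_bigr => _ /imsetP[x Dx ->]; have [Dsx sx fsx] := sD x Dx.
rewrite sum1dep_card -[RHS](_ : #|[set x; s x]| = 2)%N; last first.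
  by rewrite cards2 eq_sym sx.
congr #|pred_of_set _|; apply/setP=> y; rewrite !inE; apply/andP/orP.
  by case=> Dy /eqP fy; case: (fD x y Dx Dy (esym fy)) => ->; rewrite eqxx; [left|right].
by case=> /eqP->; rewrite ?fsx.
Qed.

(** Fibres of size at most [n] whose sizes add up to [n] times the number of targets are all full.
    Bounds on numbers of roots thus yield exact fibre sizes of trace and norm. *)
Lemma card_fibre (T U : finType) (D : {set T}) (S : {set U}) (g : T -> U) (n : nat) :
  {in D, forall x, g x \in S} ->
  {in S, forall y, #|[set x in D | g x == y]| <= n}%N ->
  #|D| = (#|S| * n)%N ->
  {in S, forall y, #|[set x in D | g x == y]| = n}.
Proof.
move=> gS len; rewrite -sum1_card (partition_big g (mem S)) //=.
rewrite -sum_nat_const.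
under eq_bigr do rewrite sum1dep_card.
move/eqP; rewrite (leqif_sum (fun y Sy => leqif_eq (len y Sy))).
by move=> /forall_inP e y /e/eqP.
Qed.

Lemma card_roots_lt (K : finFieldType) (P : {poly K}) (S : {set K}) :
  P != 0 -> {in S, forall x, root P x} -> (#|S| < size P)%N.
Proof.
move=> P0 rS; rewrite cardE; apply: max_poly_roots (enum_uniq _) => //.
by apply/allP=> x; rewrite mem_enum => /rS.
Qed.

Lemma card_frobenius_trace_le (K : finFieldType) (z : K) (n : nat) :
  (1 < n)%N -> (#|[set x | x + x ^+ n == z]%R| <= n)%N.
Proof.
move=> n1; pose P : {poly K} := 'X^n + ('X - z%:P).
have sP : size P = n.+1 by rewrite size_polyDl size_polyXn // size_XsubC.
rewrite -ltnS -sP; apply: card_roots_lt => [|x].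
  by rewrite -size_poly_eq0 sP.
rewrite inE rootE !(hornerD, hornerN, hornerX, hornerXn, hornerC) => /eqP<-.
by apply/eqP; ring.
Qed.

Lemma card_frobenius_norm_le (K : finFieldType) (z : K) (n : nat) :
  (#|[set x | x * x ^+ n == z]%R| <= n.+1)%N.
Proof.
have sP : size ('X^(n.+1) - z%:P : {poly K}) = n.+2 by rewrite size_XnsubC.
rewrite -ltnS -sP; apply: card_roots_lt => [|x].
  by rewrite -size_poly_eq0 sP.
by rewrite inE rootE !(hornerD, hornerN, hornerX, hornerXn, hornerC) exprS => /eqP->; rewrite subrr.
Qed.

(** The image of [F] already supplies as many roots of X^q - X, with q the order of [F], as its
    degree allows. *)
Lemma frobenius_fixed (F E : finFieldType) (iota : {rmorphism F -> E}) (x : E) :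
  (x ^+ #|F| == x) = (x \in iota @: F).
Proof.
suff -> : iota @: F = [set x | x ^+ #|F| == x] by rewrite inE.
apply/eqP; rewrite eqEcard; apply/andP; split.
  by apply/subsetP=> _ /imsetP[y _ ->]; rewrite inE -rmorphXn expf_card.
rewrite card_imset; last exact: fmorph_inj.
have sP : size ('X^#|F| - 'X : {poly E}) = #|F|.+1.
  by rewrite size_polyDl size_polyXn // size_polyN size_polyX ltnS finNzRing_gt1.
rewrite -ltnS -sP; apply: card_roots_lt => [|y].
  by rewrite -size_poly_eq0 sP.
by rewrite inE rootE !(hornerD, hornerN, hornerX, hornerXn, hornerC) => /eqP->; rewrite subrr.
Qed.

Lemma frobenius_sqr (F E : finFieldType) (x : E) :
  #|E| = (#|F| ^ 2)%N -> x ^+ #|F| ^+ #|F| = x.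
Proof. by move=> cE; rewrite -exprM mulnn -cE expf_card. Qed.

(** The trace maps the q^2 elements of [E] to the q elements of [F] with fibres of size at most
    q. *)
Lemma card_trace1 (F E : finFieldType) (iota : {rmorphism F -> E}) :
  ~~ odd #|F| -> #|E| = (#|F| ^ 2)%N ->
  #|[set p : E | p + p ^+ #|F| == 1]| = #|F|.
Proof.
move=> evF cE.
have -> : [set p : E | p + p ^+ #|F| == 1] = [set p in setT | p + p ^+ #|F| == 1].
  by apply/setP=> p; rewrite !inE.
apply: (card_fibre _ _ setT (iota @: F) (fun p => p + p ^+ #|F|)).
- move=> p _; rewrite -frobenius_fixed (frobenius_additive _ _ iota) //.
  by rewrite frobenius_sqr // addrC.
- move=> y _; have -> : [set p in setT | p + p ^+ #|F| == y] = [set p | p + p ^+ #|F| == y].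
    by apply/setP=> p; rewrite !inE.
  exact/card_frobenius_trace_le/finNzRing_gt1.
- by rewrite cardsT card_imset ?cE ?mulnn //; apply: fmorph_inj.
- by apply/imsetP; exists 1; rewrite ?rmorph1.
Qed.

(** The norm maps q^2 - 1 = (q - 1)(q + 1) nonzero elements to q - 1 with fibres of size at most q +
    1. *)
Lemma card_norm1 (F E : finFieldType) (iota : {rmorphism F -> E}) :
  #|E| = (#|F| ^ 2)%N -> #|[set s : E | s * s ^+ #|F| == 1]| = #|F|.+1.
Proof.
move=> cE.
have <- : [set s in [set~ 0] | s * s ^+ #|F| == 1] = [set s : E | s * s ^+ #|F| == 1].
  apply/setP=> s; rewrite !inE andb_idl //; apply: contraTneq => ->.
  by rewrite mul0r eq_sym oner_eq0.
apply: (card_fibre _ _ _ (iota @: [set~ 0]) (fun s => s * s ^+ #|F|)).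
- move=> s; rewrite !inE => s0.
  have /imsetP[y _ sy] : s * s ^+ #|F| \in iota @: F.
    by rewrite -frobenius_fixed exprMn frobenius_sqr // mulrC.
  apply/imsetP; exists y; rewrite // !inE; apply: contra_neq s0 => y0.
  move/eqP: sy; rewrite y0 rmorph0 mulf_eq0 expf_eq0 => /orP[|/andP[_]] /eqP //.
- move=> y _; apply: leq_trans (card_frobenius_norm_le _ y #|F|).
  by apply/subset_leq_card/subsetP=> s; rewrite !inE => /andP[].
- rewrite card_imset; last exact: fmorph_inj.
  by rewrite !cardsC1 cE -subn1 -(exp1n 2) subn_sqr addn1 subn1.
- by apply/imsetP; exists 1; rewrite ?rmorph1 // !inE oner_neq0.
Qed.

(* a00, a02 and a12 for the product
   (p X0 + X1 + s X2) (p' X0 + X1 + s' X2) *)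
Definition pair_coefs {R : nzRingType} (p p' s s' : R) : R * R * R :=
  (p * p', p * s' + p' * s, s + s').

(** The form determines X^2 - X + pp', with roots p, p', and X^2 - (s + s')X + 1, with roots s, s'.
    The middle coefficient tells which roots go together. *)
Lemma pair_coefs_inj (K : fieldType) (p p' s s' r r' u u' : K) :
  2%N \in [pchar K] -> p + p' = 1 -> r + r' = 1 -> s * s' = 1 -> u * u' = 1 ->
  pair_coefs p p' s s' = pair_coefs r r' u u' ->
  (r, u) = (p, s) \/ (r, u) = (p', s').
Proof.
move=> char2 pp rr ss uu [e1 e2 e3].
(* In characteristic 2 this difference is the sum p + p' = 1. *)
have pp' : p - p' != 0 by rewrite GRing.subr_pchar2 // pp oner_neq0.
have /eqP : (r - p) * (r - p') = 0.
  have -> : (r - p) * (r - p') = r * r - r * (p + p') + p * p' by ring.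
  by rewrite pp -rr e1; ring.
have /eqP : (u - s) * (u - s') = 0.
  have -> : (u - s) * (u - s') = u * u - u * (s + s') + s * s' by ring.
  by rewrite ss -uu e3; ring.
(* The middle coefficients of the two matchings differ by (p - p')(s - s'), so a mixed matching is
   possible only when s = s', where it is harmless. *)
have cross : p * s' + p' * s = p' * s' + p * s -> s = s'.
  move=> e; apply/eqP; rewrite -subr_eq0 -(mulrI_eq0 _ (mulfI pp')); apply/eqP.
  have -> : (p - p') * (s - s') = p' * s' + p * s - (p * s' + p' * s) by ring.
  by rewrite e subrr.
rewrite !mulf_eq0 !subr_eq0 => /orP[] /eqP eu /orP[] /eqP er; subst r u.
- by left.
- right; congr (_, _); apply: cross.
  by move/addrI: e3 => e3; rewrite e2 -e3 (_ : r' = p) //; apply: (addrI p'); rewrite rr addrC.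
- left; congr (_, _); apply/esym/cross; rewrite e2.
  have -> : u' = s by apply: (addrI s'); rewrite -e3 addrC.
  have -> : r' = p' by apply: (addrI p); rewrite rr.
  by rewrite addrC.
- by right.
Qed.

(** As the coefficient of X1^2 is 1, both factors involve X1 and can be divided by their X1
    coefficients, which uses up the scalar k = 1 / (l1 m1). *)
Lemma pair_coefs_normalize (K : fieldType) (k l0 l1 l2 m0 m1 m2 : K) :
  k * (l0 * m1 + l1 * m0) = 1 -> k * (l1 * m1) = 1 -> k * (l2 * m2) = 1 ->
  [/\ l0 / l1 + m0 / m1 = 1, (l2 / l1) * (m2 / m1) = 1 &
     pair_coefs (l0 / l1) (m0 / m1) (l2 / l1) (m2 / m1) =
     (k * (l0 * m0), k * (l0 * m2 + l2 * m0), k * (l1 * m2 + l2 * m1))].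
Proof.
move=> e01 e11 e22.
have : l1 * m1 != 0 by apply: contra_eqN e11 => /eqP->; rewrite mulr0 eq_sym oner_neq0.
rewrite mulf_eq0 negb_or => /andP[l10 m10].
have ek : k = (l1 * m1)^-1.
  by rewrite -[RHS]mul1r -e11 mulfK // mulf_neq0.
rewrite {}ek {k e11} in e01 e22 *; split.
- by rewrite -[RHS]e01; field; rewrite l10 m10.
- by rewrite -[RHS]e22; field; rewrite l10 m10.
by congr (_, _, _); field; rewrite l10 m10.
Qed.

(** * Criteria for the classes in terms of the pencil coordinates *)

Lemma coefs_pencil (R : nzRingType) (a b c t : R) :
  coefs (pencil a b c t) = (a, t, b, t, c, t).
Proof. exact: coefs_mat6. Qed.

Lemma disc_pencil (F : finFieldType) (a b c t : F) : 2%N \in [pchar F] ->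
  disc (pencil a b c t) = t * b * c + a * c ^+ 2 + t * b ^+ 2 + t ^+ 3.
Proof.
move=> char2; have two0 : 2%:R = 0 :> F by apply: pcharf0.
(* The difference from the sign-free expression is exhibited as a multiple of 2. *)
have -> : disc (pencil a b c t) = t * b * c + a * c ^+ 2 + t * b ^+ 2 + t ^+ 3
    + 2%:R * (2%:R * a * t * t - a * c ^+ 2 - t * b ^+ 2 - t ^+ 3).
  rewrite /disc !pencilE; ring.
by rewrite two0 mul0r addr0.
Qed.

Lemma proportional_row3 (F : finFieldType) (x x' z z' : F) :
  proportional (row3 x 1 z) (row3 x' 1 z') -> x = x'.
Proof.
case/existsP=> c /orP[] /eqP/matrixP e; move: (e 0 i0) (e 0 i1);
  by rewrite !mxE !inordK //= mulr1 => -> <-; rewrite mul1r.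
Qed.

(** In characteristic 2 a square of a linear form has no mixed terms, which leaves only a X0^2. *)
Lemma double_line_pencil (F : finFieldType) (a b c t : F) : 2%N \in [pchar F] ->
  double_line (pencil a b c t) = [&& b == 0, c == 0 & t == 0].
Proof.
move=> char2; apply/existsP/and3P => [[k /existsP[l /qform_lform2P]]|].
  rewrite coefs_pencil /lform2_coefs !(mulrC (l 0 i1) (l 0 i0)) !(mulrC (l 0 i2)).
  by rewrite !addrr_pchar2 // !mulr0 => -[_ -> -> _ -> _].
move=> [/eqP-> /eqP-> /eqP->]; exists a; apply/existsP; exists (row3 1 0 0).
apply/qform_lform2P; rewrite coefs_pencil /lform2_coefs !row3E.
by congr (_, _, _, _, _, _); ring.
Qed.

(** The conditions p + p' = 1 and s s' = 1 are solved by p' = p + 1 and s' = s^-1; since p + 1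
    differs from p, the factors are never proportional. *)
Lemma real_line_pair_pencil1P (F : finFieldType) (a b c : F) : 2%N \in [pchar F] ->
  reflect (exists2 v : F * F, v.2 != 0 &
             (a, b, c) = pair_coefs v.1 (v.1 + 1) v.2 v.2^-1)
          (real_line_pair (pencil a b c 1)).
Proof.
move=> char2; apply: (iffP existsP) => [[l /existsP[m /andP[_]]]|[[p s] /= s0 [-> -> ->]]].
  rewrite -[lform _ * _]scale1r => /qform_lform2P.
  rewrite coefs_pencil /lform2_coefs => -[-> e01 -> e11 -> e22].
  have [pp ss <-] := pair_coefs_normalize _ _ _ _ _ _ _ _ (esym e01) (esym e11) (esym e22).
  have s0 : l 0 i2 / l 0 i1 != 0.
    by apply: contra_eqN ss => /eqP->; rewrite mul0r eq_sym oner_neq0.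
  exists (l 0 i0 / l 0 i1, l 0 i2 / l 0 i1); rewrite //=.
  congr (pair_coefs _ _ _ _); last by apply: (mulfI s0); rewrite ss divff.
  by rewrite -pp addrA addrr_pchar2 ?add0r.
exists (row3 p 1 s); apply/existsP; exists (row3 (p + 1) 1 s^-1).
apply/andP; split.
  apply/negP=> /proportional_row3/eqP.
  by rewrite -subr_eq0 opprD addrA subrr add0r oppr_eq0 oner_eq0.
rewrite -[lform _ * _]scale1r; apply/qform_lform2P; rewrite coefs_pencil /lform2_coefs !row3E.
congr (_, _, _, _, _, _); rewrite ?divff //; try ring.
by rewrite mul1r mulr1 mul1r addrA addrr_pchar2 ?add0r.
Qed.

(** Without X1^2 one factor lacks X1; the term X1 X2 makes the other contain it, and the absence of
    X0 X1 removes X0 from the first, so a = 0. Conversely the form is X2 (b X0 + X1). *)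
Lemma real_line_pair_pencil01 (F : finFieldType) (a b : F) : 2%N \in [pchar F] ->
  real_line_pair (pencil a b 1 0) = (a == 0).
Proof.
move=> char2; apply/existsP/eqP => [[l /existsP[m /andP[_]]]|->].
  rewrite -[lform _ * _]scale1r => /qform_lform2P.
  rewrite coefs_pencil /lform2_coefs !mul1r => -[-> e01 e02 e11 e12 e22].
  move/esym/eqP: e11; rewrite mulf_eq0 => /orP[] /eqP z; move: e01 e12; rewrite z.
    rewrite !mul0r addr0 add0r => /esym/eqP; rewrite mulf_eq0 => /orP[/eqP->|/eqP z'].
      by rewrite mul0r.
    by move=> /esym/eqP; rewrite z' mulr0 eq_sym oner_eq0.
  rewrite !mulr0 add0r addr0 => /esym/eqP; rewrite mulf_eq0 => /orP[/eqP z'|/eqP->].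
    by move=> /esym/eqP; rewrite z' mul0r eq_sym oner_eq0.
  by rewrite mulr0.
exists (row3 0 0 1); apply/existsP; exists (row3 b 1 0); apply/andP; split.
  apply/negP=> /existsP[c /orP[] /eqP/matrixP e].
    by move/eqP: (e 0 i2); rewrite !mxE !inordK //= mulr0 oner_eq0.
  by move/eqP: (e 0 i1); rewrite !mxE !inordK //= mulr0 oner_eq0.
rewrite -[lform _ * _]scale1r; apply/qform_lform2P; rewrite coefs_pencil /lform2_coefs !row3E.
by congr (_, _, _, _, _, _); ring.
Qed.

Lemma real_line_pair_pencil001 (F : finFieldType) (a : F) :
  real_line_pair (pencil a 1 0 0).
Proof.
apply/existsP; exists (row3 1 0 0); apply/existsP; exists (row3 a 0 1).
apply/andP; split.
  apply/negP=> /existsP[c /orP[] /eqP/matrixP e]; last first.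
    by move/eqP: (e 0 i2); rewrite !mxE !inordK //= mulr0 oner_eq0.
  move: (e 0 i0) (e 0 i2); rewrite !mxE !inordK //= mulr1 => + c0.
  by rewrite -c0 mul0r => /eqP; rewrite oner_eq0.
rewrite -[lform _ * _]scale1r; apply/qform_lform2P; rewrite coefs_pencil /lform2_coefs !row3E.
by congr (_, _, _, _, _, _); ring.
Qed.

(** In a factorisation of X0^2 the vanishing X0 X1 and X0 X2 terms force each l_i to be (l0 / m0)
    m_i. *)
Lemma real_line_pair_pencil0001 (F : finFieldType) : 2%N \in [pchar F] ->
  ~~ real_line_pair (pencil (1 : F) 0 0 0).
Proof.
move=> char2; apply/negP=> /existsP[l /existsP[m /andP[/negP lm]]].
rewrite -[lform _ * _]scale1r => /qform_lform2P.
rewrite coefs_pencil /lform2_coefs !mul1r => -[e00 e01 e02 _ _ _]; apply: lm.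
have m0 : m 0 i0 != 0 by apply: contra_eqN e00 => /eqP->; rewrite mulr0 oner_neq0.
have cross x y : 0 = l 0 i0 * x + y * m 0 i0 -> y = l 0 i0 / m 0 i0 * x.
  move=> /esym/eqP; rewrite addr_eq0 oppr_pchar2 // => /eqP e.
  by rewrite mulrAC e mulfK.
apply/existsP; exists (l 0 i0 / m 0 i0); apply/orP; left; apply/eqP/matrixP.
by move=> i; rewrite (ord1 i); elim/ord3_ind; rewrite mxE ?divfK //; apply: cross.
Qed.

(** The coefficients of X1^2 and X2^2 are k times norms, so their vanishing kills l1 and l2, and a
    multiple of X0 is proportional to its conjugate. *)
Lemma imaginary_line_pair_pencil0 (F E : finFieldType) (iota : {rmorphism F -> E})
    (a b c : F) :
  (a, b, c) != (0, 0, 0) -> ~~ imaginary_line_pair iota (pencil a b c 0).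
Proof.
apply: contraNN => /existsP[k /existsP[l /andP[ll /qform_lform2P]]].
have -> : coefs (map_mx iota (pencil a b c 0)) = (iota a, 0, iota b, 0, iota c, 0).
  by rewrite /coefs !(mxE map_mx_key) !pencilE !rmorph0.
rewrite /lform2_coefs !(mxE map_mx_key).
have [->|k0] := eqVneq k 0.
  rewrite rmorph0 !mul0r => -[/eqP + /eqP + /eqP +].
  by rewrite !fmorph_eq0 => /eqP-> /eqP-> /eqP->; rewrite eqxx.
have norm0 x : 0 = iota k * (x * x ^+ #|F|) -> x = 0.
  move=> /esym/eqP; rewrite mulf_eq0 fmorph_eq0 (negPf k0) /= mulf_eq0 expf_eq0.
  by case/orP=> [/eqP//|/andP[_ /eqP]].
case=> _ _ _ /norm0 l1 _ /norm0 l2; case/existsP: ll.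
exists (l 0 i0 / l 0 i0 ^+ #|F|); apply/orP; left; apply/eqP/matrixP=> i.
rewrite (ord1 i); elim/ord3_ind; rewrite !mxE ?l1 ?l2 ?expr0n ?(gtn_eqF (ltnW (finNzRing_gt1 F))) ?mulr0 //.
have [->|l0] := eqVneq (l 0 i0) 0; first by rewrite !mul0r.
by rewrite divfK // expf_neq0.
Qed.

(** Dividing by the X1 coefficient commutes with conjugation, so the normalised factors stay
    conjugate. Trace 1 makes p differ from its conjugate, hence the factors are not proportional. *)
Lemma imaginary_line_pair_pencil1P (F E : finFieldType) (iota : {rmorphism F -> E})
    (a b c : F) : 2%N \in [pchar F] ->
  reflect (exists2 v : E * E,
             (v.1 + v.1 ^+ #|F| == 1) && (v.2 * v.2 ^+ #|F| == 1) &
             (iota a, iota b, iota c) =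
             pair_coefs v.1 (v.1 ^+ #|F|) v.2 (v.2 ^+ #|F|))
          (imaginary_line_pair iota (pencil a b c 1)).
Proof.
move=> char2F; have char2 : 2%N \in [pchar E] by rewrite (fmorph_pchar iota).
have ec : coefs (map_mx iota (pencil a b c 1)) = (iota a, 1, iota b, 1, iota c, 1).
  by rewrite /coefs !(mxE map_mx_key) !pencilE !rmorph1.
apply: (iffP existsP) => [[k /existsP[l /andP[_ /qform_lform2P]]]|].
  rewrite ec /lform2_coefs !(mxE map_mx_key) => -[-> e01 -> e11 -> e22].
  have := pair_coefs_normalize _ _ _ _ _ _ _ _ (esym e01) (esym e11) (esym e22).
  rewrite -!expr_div_n => -[pp ss <-].
  by exists (l 0 i0 / l 0 i1, l 0 i2 / l 0 i1); rewrite //= pp ss eqxx.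
move=> [[p s] /= /andP[/eqP pp /eqP ss] [ea eb ec']].
exists 1; apply/existsP; exists (row3 p 1 s).
have -> : conj_form F (row3 p 1 s) = row3 (p ^+ #|F|) 1 (s ^+ #|F|).
  apply/matrixP=> i; rewrite (ord1 i); elim/ord3_ind;
  by rewrite !mxE !inordK //= expr1n.
apply/andP; split.
  apply/negP=> /proportional_row3 e; move/eqP: pp; rewrite -e addrr_pchar2 //.
  by rewrite eq_sym oner_eq0.
apply/qform_lform2P; rewrite ec /lform2_coefs !row3E rmorph1 ea eb ec'.
by rewrite !mulr1 !mul1r pp ss (mulrC s) (addrC s).
Qed.

(** * The four counts on the representative line *)

Lemma num_double_line (F : finFieldType) : 2%N \in [pchar F] ->
  num_containing (line13_3 F) (hyperplanes_of (@double_line F)) = 1%N.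
Proof.
move=> char2; rewrite num_containing_line13_3 //; last exact: double_line_class.
rewrite card_conic_rep double_line_pencil // !eqxx /=.
by rewrite !(eq_card0 (A := [set _ | _])) // => v;
  rewrite !inE double_line_pencil // oner_eq0 ?andbF.
Qed.

(** There are q choices of p and q - 1 of s; the exchange (p + 1, s^-1) has no fixed point. *)
Lemma card_real_pencil1 (F : finFieldType) : 2%N \in [pchar F] ->
  (#|[set v : F * F * F | real_line_pair (pencil v.1.1 v.1.2 v.2 1)]| * 2 =
   #|F| * #|F|.-1)%N.
Proof.
move=> char2.
pose f (v : F * F) := pair_coefs v.1 (v.1 + 1) v.2 v.2^-1.
pose D : {set F * F} := [set v | v.2 != 0].
have -> : [set v : F * F * F | real_line_pair (pencil v.1.1 v.1.2 v.2 1)] = f @: D.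
  apply/setP=> -[[a b] c]; rewrite inE /=.
  apply/(real_line_pair_pencil1P F a b c char2)/imsetP => -[v Dv e];
    by exists v => //; move: Dv; rewrite inE.
rewrite -(card_two_to_one _ _ D f (fun v => (v.1 + 1, v.2^-1))).
- have -> : D = setX setT [set~ 0] by apply/setP=> v; rewrite !inE.
  by rewrite cardsX cardsT cardsC1.
- move=> [p s]; rewrite !inE /= => s0; split.
  + by rewrite invr_eq0.
  + by rewrite xpair_eqE -subr_eq0 addrAC subrr add0r oner_eq0.
  + rewrite /f /pair_coefs /= invrK -addrA addrr_pchar2 // addr0.
    by congr (_, _, _); ring.
move=> [p s] [r u]; rewrite !inE /= => s0 u0 e.
have h (x : F) : x + (x + 1) = 1 by rewrite addrA addrr_pchar2 // add0r.
exact: pair_coefs_inj char2 (h p) (h r) (divff s0) (divff u0) e.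
Qed.

Lemma num_real_line_pair (F : finFieldType) : 2%N \in [pchar F] ->
  num_containing (line13_3 F) (hyperplanes_of (@real_line_pair F)) =
  ((#|F| ^ 2 + 3 * #|F|) %/ 2)%N.
Proof.
move=> char2; rewrite num_containing_line13_3 //; last exact: real_line_pair_class.
rewrite card_conic_rep (negPf (real_line_pair_pencil0001 F char2)).
have -> : #|[set v : F * F | real_line_pair (pencil v.1 v.2 1 0)]| = #|F|.
  have -> : [set v : F * F | real_line_pair (pencil v.1 v.2 1 0)] = setX [set 0] setT.
    by apply/setP=> v; rewrite !inE real_line_pair_pencil01 ?andbT.
  by rewrite cardsX cards1 cardsT mul1n.
have -> : #|[set a : F | real_line_pair (pencil a 1 0 0)]| = #|F|.
  by rewrite -cardsT; apply: eq_card => a; rewrite !inE real_line_pair_pencil001.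
have := card_real_pencil1 F char2; have := finNzRing_gt1 F.
set n := #|[set _ | _]|; move: #|F| n => q n q1 e.
(* The summands are the strata t = 1, then a12 = 1, then a02 = 1, then X0^2, which contributes
   nothing. *)
have -> : (q ^ 2 + 3 * q = (n + q + q + false) * 2)%N.
  by case: q q1 e => // q _ /= e; rewrite !mulnDl e; lia.
by rewrite mulnK.
Qed.

(** The count is made among triples over [E]: q elements p of trace 1, q + 1 elements s of norm 1,
    with conjugation as the exchange of factors. *)
Lemma card_imaginary_pencil1 (F E : finFieldType) (iota : {rmorphism F -> E}) :
  ~~ odd #|F| -> #|E| = (#|F| ^ 2)%N ->
  (#|[set v : F * F * F | imaginary_line_pair iota (pencil v.1.1 v.1.2 v.2 1)]| * 2
   = #|F| * #|F|.+1)%N.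
Proof.
move=> evF cE; have char2F := pchar2_even_card F evF.
have char2 : 2%N \in [pchar E] by rewrite (fmorph_pchar iota).
have frobD := frobenius_additive F E iota.
have frobK x := frobenius_sqr F E x cE.
pose f (v : E * E) := pair_coefs v.1 (v.1 ^+ #|F|) v.2 (v.2 ^+ #|F|).
pose D := setX [set p : E | p + p ^+ #|F| == 1] [set s : E | s * s ^+ #|F| == 1].
pose iota3 (v : F * F * F) := (iota v.1.1, iota v.1.2, iota v.2).
have iota3_inj : injective iota3.
  by move=> [[a b] c] [[a' b'] c'] [] /fmorph_inj-> /fmorph_inj-> /fmorph_inj->.
rewrite -(card_imset _ iota3_inj).
have -> : iota3 @: [set v | imaginary_line_pair iota (pencil v.1.1 v.1.2 v.2 1)] = f @: D.
  apply/setP=> w; apply/imsetP/imsetP => [[[[a b] c]]|[v]].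
    rewrite inE /= => /(imaginary_line_pair_pencil1P _ _ _ _ _ _ char2F)[v v1 e] ->.
    by exists v; rewrite ?inE.
  rewrite !inE => Dv ew; case: v Dv ew => p s /= /andP[/eqP pp /eqP ss].
  (* Each coefficient of the product is fixed by conjugation and therefore comes from [F]. *)
  have /imsetP[a _ ea] : p * p ^+ #|F| \in iota @: F.
    by rewrite -frobenius_fixed exprMn frobK mulrC.
  have /imsetP[b _ eb] : p * s ^+ #|F| + p ^+ #|F| * s \in iota @: F.
    by rewrite -frobenius_fixed frobD // !exprMn !frobK addrC mulrC [X in X + _]mulrC mulrC.
  have /imsetP[c _ ec] : s + s ^+ #|F| \in iota @: F.
    by rewrite -frobenius_fixed frobD // frobK addrC.
  rewrite /f /pair_coefs /= ea eb ec => ->; exists (a, b, c) => //.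
  rewrite inE; apply/imaginary_line_pair_pencil1P => //.
  by exists (p, s); rewrite /= ?pp ?ss ?eqxx // /pair_coefs ea eb ec.
rewrite -(card_two_to_one _ _ D f (fun v => (v.1 ^+ #|F|, v.2 ^+ #|F|))).
- by rewrite cardsX (card_trace1 F E iota) // (card_norm1 F E iota).
- move=> [p s]; rewrite !inE /= => /andP[/eqP pp ss]; rewrite !frobK; split.
  + by rewrite addrC pp eqxx mulrC.
  + rewrite xpair_eqE negb_and; apply/orP; left; apply: contra_eqN pp => /eqP->.
    by rewrite addrr_pchar2 // eq_sym oner_eq0.
  + by rewrite /f /pair_coefs /= !frobK; congr (_, _, _); ring.
move=> [p s] [r u]; rewrite !inE /= => /andP[/eqP pp /eqP ss] /andP[/eqP rr /eqP uu] e.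
exact: pair_coefs_inj char2 pp rr ss uu e.
Qed.

Lemma num_imaginary_line_pair (F E : finFieldType) (iota : {rmorphism F -> E}) :
  ~~ odd #|F| -> #|E| = (#|F| ^ 2)%N ->
  num_containing (line13_3 F) (hyperplanes_of (imaginary_line_pair iota)) =
  ((#|F| ^ 2 + #|F|) %/ 2)%N.
Proof.
move=> evF cE; have char2 := pchar2_even_card F evF.
rewrite num_containing_line13_3 //; last exact: imaginary_line_pair_class.
rewrite card_conic_rep (negPf (imaginary_line_pair_pencil0 F E iota 1 0 0 _)); last first.
  by rewrite !xpair_eqE oner_eq0.
rewrite (eq_card0 (A := [set v : F * F | _])) => [|v]; last first.
  rewrite inE; apply/negbTE/imaginary_line_pair_pencil0.
  by rewrite !xpair_eqE oner_eq0 !andbF.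
rewrite (eq_card0 (A := [set a : F | _])) => [|a]; last first.
  rewrite inE; apply/negbTE/imaginary_line_pair_pencil0.
  by rewrite !xpair_eqE oner_eq0 !andbF.
have <- : (#|F| * #|F|.+1 = #|F| ^ 2 + #|F|)%N by rewrite mulnS addnC mulnn.
by rewrite -(card_imaginary_pencil1 F E iota evF cE) mulnK ?addn0.
Qed.

Lemma card_singular_pencil1 (F : finFieldType) : 2%N \in [pchar F] ->
  #|[set v : F * F * F | disc (pencil v.1.1 v.1.2 v.2 1) == 0]| = (#|F| ^ 2)%N.
Proof.
move=> char2.
(* The second parameter is a12. The first is a00 when a12 = 0, where b^2 = 1 forces a02 = 1, and is
   a02 otherwise. *)
pose g (w : F * F) := if w.2 == 0 then (w.1, 1, 0) else
  ((w.1 * w.2 + w.1 ^+ 2 + 1) / w.2 ^+ 2, w.1, w.2).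
have g_inj : injective g.
  move=> [u c] [u' c']; rewrite /g /=.
  case: (eqVneq c 0) (eqVneq c' 0) => [->|c0] [->|c0'] [] //.
  - by move=> ->.
  - by move=> _ _ e; rewrite -e eqxx in c0'.
  - by move=> _ _ e; rewrite e eqxx in c0.
  - by move=> _ -> ->.
rewrite -mulnn -card_prod -(card_imset _ g_inj).
apply: eq_card => -[[a b] c]; rewrite inE /= disc_pencil // !mul1r expr1n.
apply/eqP/imsetP => [e|[[u d] _]]; last first.
  rewrite /g /=; case: eqP => [_|/eqP d0] [-> -> ->].
    by rewrite mulr0 expr0n /= mulr0 !add0r expr1n addrr_pchar2.
  rewrite divfK ?expf_neq0 //.
  have -> : u * d + (u * d + u ^+ 2 + 1) + u ^+ 2 + 1 =
    (u * d + u ^+ 2 + 1) + (u * d + u ^+ 2 + 1) by ring.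
  by rewrite addrr_pchar2.
have [c0|c0] := eqVneq c 0.
  exists (a, 0) => //; rewrite /g /= eqxx c0.
  move: e; rewrite c0 mulr0 expr0n /= mulr0 !add0r => /eqP.
  by rewrite addr_eq0 oppr_pchar2 // sqrf_eq1 oppr_pchar2 // orbb => /eqP->.
exists (b, c) => //; rewrite /g /= (negPf c0); congr (_, _, _).
apply: (mulIf (expf_neq0 2 c0)); rewrite divfK ?expf_neq0 //.
apply/eqP; rewrite -[X in _ == X](oppr_pchar2 char2) -addr_eq0 -e; apply/eqP; ring.
Qed.

Lemma num_nonsingular (F : finFieldType) : 2%N \in [pchar F] ->
  num_containing (line13_3 F) (hyperplanes_of (@nonsingular F)) =
  (#|F| ^ 3 - #|F|)%N.
Proof.
move=> char2; rewrite num_containing_line13_3 //; last exact: nonsingular_class.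
rewrite card_conic_rep /nonsingular.
have -> : #|[set v : F * F * F | disc (pencil v.1.1 v.1.2 v.2 1) != 0]| =
    (#|F| ^ 3 - #|F| ^ 2)%N.
  have -> : [set v : F * F * F | disc (pencil v.1.1 v.1.2 v.2 1) != 0] =
      ~: [set v | disc (pencil v.1.1 v.1.2 v.2 1) == 0].
    by apply/setP=> v; rewrite !inE.
  rewrite cardsCs setCK card_singular_pencil1 // !card_prod.
  by rewrite !expnS expn0 muln1 mulnA.
(* For t = 0 and a12 = 1 the discriminant is a00, and a02 is free. *)
have -> : #|[set v : F * F | disc (pencil v.1 v.2 1 0) != 0]| = (#|F| ^ 2 - #|F|)%N.
  have -> : [set v : F * F | disc (pencil v.1 v.2 1 0) != 0] = setX [set~ 0] setT.
    apply/setP=> v; rewrite !inE disc_pencil // !mul0r !addr0 add0r.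
    by rewrite expr1n mulr1 expr0n addr0 andbT.
  by rewrite cardsX cardsC1 cardsT -subn1 mulnBl mul1n mulnn.
rewrite eq_card0 => [|a]; last first.
  by rewrite !inE disc_pencil // !mul0r !expr0n /= mulr0 !addr0 eqxx.
rewrite disc_pencil // !mul0r !expr0n /= mulr0 !addr0 eqxx !addn0.
have q1 := finNzRing_gt1 F.
(* The truncated differences telescope because q <= q^2 <= q^3. *)
rewrite addnBA ?subnK // ?leq_exp2l // -{1}(expn1 #|F|) leq_exp2l //; lia.
Qed.

Theorem lemma4p13 (F E : finFieldType) (iota : {rmorphism F -> E}) (q : nat)
    (cardF : #|F| = q) (cardE : #|E| = (q ^ 2)%N) (q_even : ~~ odd q)
    (L : {set {set 'M[F]_3}}) (HL : L \in o13_3 F) :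
  OD4 iota L =
    [:: 1; (q ^ 2 + 3 * q) %/ 2; (q ^ 2 + q) %/ 2; q ^ 3 - q]%N.
Proof.
move: q_even cardE; rewrite -cardF => evF cE; have char2 := pchar2_even_card F evF.
rewrite /OD4 !(num_containing_orbit _ _ (line13_3 F) L _ HL).
- by rewrite num_double_line // num_real_line_pair // num_imaginary_line_pair //
    num_nonsingular.
- exact: nonsingular_class.
- exact: imaginary_line_pair_class.
- exact: real_line_pair_class.
- exact: double_line_class.
Qed.
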